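(* Let $G$ be a countable group and let $H\triangleleft G$ be a normal subgroup which is a torsion group (every element of $H$ has finite order). Then $G/H$ is algebraically recurrent if and only if $G$ is algebraically recurrent.
   Context: For a countable group $G$ and a probability measure $\mu$ on $G$, a $\mu$-random walk is $X_n=\zeta_1\cdots\zeta_n$ with $\zeta_i$ i.i.d. of law $\mu$. Let $\mathcal{S}_n$ be the semigroup (not subgroup) generated by $\{X_n,X_{n+1},\ldots\}$. The pair $(G,\mu)$ is algebraically recurrent (AR) if for every $n$, $\mathcal{S}_n=G$ almost surely. The group $G$ is AR if $(G,\mu)$ is AR for every symmetric probability measure $\mu$ (i.e. $\mu(g)=\mu(g^{-1})$) whose support generates $G$ as a group. *)

(* Defs.v *)
From HB Require Import structures.
From mathcomp Require Import all_boot all_order all_algebra.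
From mathcomp Require Import all_classical all_reals all_analysis.
Set Implicit Arguments. Unset Strict Implicit. Unset Printing Implicit Defensive.
Import Order.TTheory GRing.Theory Num.Theory.
Local Open Scope classical_set_scope.
Local Open Scope ring_scope.

Record cgroup := CGroup {
  gcar :> countType;
  gmul : gcar -> gcar -> gcar;
  ginv : gcar -> gcar;
  gone : gcar;
  gmulA : associative gmul;
  gmul1g : left_id gone gmul;
  gmulVg : forall x, gmul (ginv x) x = gone }.

Section Defs.
Variable G : cgroup.

Definition gprod (s : seq G) : G := foldr (@gmul G) (@gone G) s.

Definition gpow (x : G) (n : nat) : G := gprod (nseq n x).

Definition semigroup_gen (A : set G) : set G :=
  [set g | exists s : seq G, s != [::] /\ (forall x, x \in s -> A x) /\ g = gprod s].

Definition group_gen (A : set G) : set G :=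
  [set g | exists s : seq G,
     (forall x, x \in s -> A x \/ A (ginv x)) /\ g = gprod s].

Definition normal_subgroup (H : set G) : Prop :=
  [/\ H (gone G),
      (forall x y, H x -> H y -> H (gmul x y)),
      (forall x, H x -> H (ginv x)) &
      (forall g h, H h -> H (gmul (gmul (ginv g) h) g))].

Definition torsion_set (H : set G) : Prop :=
  forall h, H h -> exists n : nat, (0 < n)%N /\ gpow h n = gone G.

Variable R : realType.

Definition prob_on (mu : G -> R) : Prop :=
  (forall g, 0 <= mu g) /\ (\esum_(g in [set: G]) (mu g)%:E = 1%E).

Definition symmetric_prob (mu : G -> R) : Prop := forall g, mu g = mu (ginv g).

Definition support (mu : G -> R) : set G := [set g | 0 < mu g].

(* zeta is an i.i.d. sequence of G-valued random variables with law mu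
   (for discrete random variables: the product formula on point events
   over every finite set of distinct indices). *)
Definition iid_law {d} {Omega : measurableType d} (P : probability Omega R)
  (zeta : nat -> Omega -> G) (mu : G -> R) : Prop :=
  (forall i g, measurable [set w | zeta i w = g]) /\
  (forall (s : seq nat) (f : nat -> G), uniq s ->
     P (\bigcap_(i in [set` s]) [set w | zeta i w = f i])
       = (\prod_(i <- s) mu (f i))%:E).

(* random walk X_n = zeta_1 ... zeta_n (indices shifted to start at 0) *)
Definition rwalk {Omega : Type} (zeta : nat -> Omega -> G) (n : nat) (w : Omega) : G :=
  gprod [seq zeta i w | i <- iota 0 n].

Definition AR_pair (mu : G -> R) : Prop :=
  forall (d : measure_display) (Omega : measurableType d)
         (P : probability Omega R) (zeta : nat -> Omega -> G),
    iid_law P zeta mu ->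
    forall n : nat,
      {ae P, forall w, semigroup_gen [set rwalk zeta m w | m in [set m | (n <= m)%N]]
                         = [set: G]}.

Definition AR_group : Prop :=
  forall mu : G -> R, prob_on mu -> symmetric_prob mu ->
    group_gen (support mu) = [set: G] -> AR_pair mu.

End Defs.

Definition group_hom (G Q : cgroup) (pi : G -> Q) : Prop :=
  forall x y, pi (gmul x y) = gmul (pi x) (pi y).

(* Main.v *)
Require Import Defs.
From HB Require Import structures.
From mathcomp Require Import all_boot all_order all_algebra.
From mathcomp Require Import all_classical all_reals all_analysis.
Set Implicit Arguments. Unset Strict Implicit. Unset Printing Implicit Defensive.
Import Order.TTheory GRing.Theory Num.Theory numFieldNormedType.Exports.
Local Open Scope classical_set_scope.
Local Open Scope ring_scope.

(** If the semigroup S generated by X_n, X_(n+1), ... maps onto G/H then every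
s in S has some t in S with st in H; since st is torsion, s is invertible in S.
So S is a group, it contains the increments after time n, hence almost surely
the whole support of mu.

Conversely, a symmetric law nu on G/H lifts to a symmetric law mu on G that is
positive on the whole preimage of the support of nu, hence generates G. The
projection of a mu-walk is a nu-walk, but the nu-walk one is given need not be
such a projection: its probability space may be too poor. Instead a mu-walk is
built on [0, 1) by iterating a piecewise affine expanding map, and the almost
sure property is transferred between the two nu-walks, as it only depends on
the laws of their finite prefixes. *)

(** * Countable sums and independent sequences *)

Section esum_extra.
Context {R : realType}.

Lemma esumZl (T : choiceType) (D : set T) (a : T -> \bar R) (c : R) :
  0 <= c -> (forall t, 0 <= a t)%E ->
  (\esum_(t in D) (c%:E * a t) = c%:E * \esum_(t in D) a t)%E.
Proof.
move=> c0 a0; rewrite /esum -ereal_supZl//; last first.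
  by apply/set0P; exists (\sum_(t \in set0) a t)%E, set0 => //; exact: fsets_set0.
rewrite image_comp; congr (ereal_sup _).
apply: eq_imagel => A [finA AD] /=.
by rewrite ge0_mule_fsumr.
Qed.

(** The pairs [(u, t)] with [f t = u] correspond to the points [t] of the preimage through the
    second projection. *)
Lemma esum_fibers (T U : choiceType) (f : T -> U) (D : set U) (a : T -> \bar R) :
  (forall t, 0 <= a t)%E ->
  (\esum_(u in D) \esum_(t in f @^-1` [set u]) a t
   = \esum_(t in f @^-1` D) a t)%E.
Proof.
move=> a0; rewrite esum_esum; last by move=> u t.
apply/esym/(@reindex_esum _ _ _ _ _ snd) => //; split.
- by move=> [u t] [Du /= ft]; rewrite ft.
- by move=> [u t] [v t'] /[!inE] -[_ /= <-] [_ /= <-] ->.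
- by move=> t Dt; exists (f t, t).
Qed.

End esum_extra.

Section discrete_random_variables.
Context {d} {Omega : measurableType d} {R : realType} {T : countType}.
Variable Y : Omega -> T.
Hypothesis mY : forall t, measurable [set w | Y w = t].

Lemma measurable_discrete (D : set T) : measurable [set w | D (Y w)].
Proof.
rewrite (_ : [set w | _] = \bigcup_t ([set w | Y w = t] `&` [set w | D t])).
  apply: countable_bigcupT_measurable => [|t]; first exact: countableP.
  apply: measurableI => //; have [Dt|nDt] := pselect (D t).
    by rewrite (_ : [set w | _] = setT)//; apply/seteqP; split.
  by rewrite (_ : [set w | _] = set0)//; apply/seteqP; split.
apply/seteqP; split => [w Dw|w [t _ [/= <-]]]//.
by exists (Y w).
Qed.

(** Encoding the values of [Y] by [pickle] turns the event into a disjoint union indexed by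
    naturals, to which countable additivity applies. *)
Lemma measure_discrete_sum (P : {measure set Omega -> \bar R}) (E : set Omega)
  (D : set T) : measurable E ->
  (P (E `&` [set w | D (Y w)])
   = \esum_(t in D) P (E `&` [set w | Y w = t]))%E.
Proof.
move=> mE; pose F n := E `&` [set w | pickle (Y w) = n].
have mF n : measurable (F n).
  by apply: measurableI => //; exact: (measurable_discrete [set t | pickle t = n]).
have -> : E `&` [set w | D (Y w)] = \bigcup_(n in pickle @` D) F n.
  apply/seteqP; split => [w [Ew Dw]|w [_ [t Dt <-] [Ew /= Yt]]].
    by exists (pickle (Y w)) => //; exists (Y w).
  by split => //=; rewrite (pcan_inj pickleK Yt).
rewrite measure_bigcup//; last first.
  by move=> m n _ _ [w [[_ /= <-] [_ /= <-]]].
rewrite nneseries_esum// (_ : [set x | _] = pickle @` D); last first.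
  by apply/seteqP; split => n /=; rewrite inE.
rewrite esum_image; last by move=> x y _ _; exact: (pcan_inj pickleK).
apply: eq_esum => t _; congr (P (_ `&` _)).
by apply/seteqP; split => [w /(pcan_inj pickleK)//|w /= ->].
Qed.

End discrete_random_variables.

(* [iid_law] for an alphabet without a group structure; on the carrier of a
   [cgroup] the two are convertible. *)
Definition iid {d} {Omega : measurableType d} {R : realType} {T : countType}
    (P : probability Omega R) (zeta : nat -> Omega -> T) (mu : T -> R) : Prop :=
  (forall i t, measurable [set w | zeta i w = t]) /\
  (forall (s : seq nat) (f : nat -> T), uniq s ->
     P (\bigcap_(i in [set` s]) [set w | zeta i w = f i])
       = (\prod_(i <- s) mu (f i))%:E).

(** The image law as a real-valued mass function. For a law [mu] of total mass 1 each fiber sum is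
    at most 1, so [fine] loses nothing. *)
Definition pushfwd {R : realType} {T U : choiceType} (f : T -> U) (mu : T -> R)
    (u : U) : R :=
  fine (\esum_(t in f @^-1` [set u]) (mu t)%:E)%E.

Section pushfwd.
Context {R : realType} {T U : choiceType} (f : T -> U) (mu : T -> R).
Hypothesis mu0 : forall t, 0 <= mu t.
Hypothesis mu1 : (\esum_(t in [set: T]) (mu t)%:E = 1)%E.

Lemma pushfwdE u :
  ((pushfwd f mu u)%:E = \esum_(t in f @^-1` [set u]) (mu t)%:E)%E.
Proof.
rewrite fineK// ge0_fin_numE; last by apply: esum_ge0 => t _; rewrite lee_fin.
rewrite (@le_lt_trans _ _ 1%E)// ?ltry// -mu1 esum_mkcond.
by apply: le_esum => t _; case: ifP => // _; rewrite lee_fin.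
Qed.

Lemma pushfwd_ge0 u : 0 <= pushfwd f mu u.
Proof. by apply: fine_ge0; apply: esum_ge0 => t _; rewrite lee_fin. Qed.

Lemma pushfwd_sum1 : (\esum_(u in [set: U]) (pushfwd f mu u)%:E = 1)%E.
Proof.
rewrite -mu1 -(preimage_setT f) -esum_fibers; last by move=> t; rewrite lee_fin.
by apply: eq_esum => u _; rewrite pushfwdE.
Qed.

Lemma pushfwd_ge t : mu t <= pushfwd f mu (f t).
Proof.
rewrite -lee_fin pushfwdE -(esum_set1 (t := t) (a := fun t => (mu t)%:E)) ?lee_fin//.
rewrite esum_mkcond [leRHS]esum_mkcond; apply: le_esum => x _.
case: ifPn => [|_]; first by rewrite inE => /= ->; rewrite mem_set.
by case: ifP => // _; rewrite lee_fin.
Qed.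

Lemma pushfwd_id t : pushfwd id mu t = mu t.
Proof. by rewrite /pushfwd preimage_id esum_set1// lee_fin. Qed.

End pushfwd.

Lemma pushfwd_comp {R : realType} {T U V : choiceType} (f : T -> U) (g : U -> V)
    (mu : T -> R) : (forall t, 0 <= mu t) ->
    (\esum_(t in [set: T]) (mu t)%:E = 1)%E ->
  pushfwd g (pushfwd f mu) = pushfwd (g \o f) mu.
Proof.
move=> mu0 mu1; apply/funext => v; congr fine.
rewrite comp_preimage -[RHS]esum_fibers; last by move=> t; rewrite lee_fin.
by apply: eq_esum => u _; rewrite pushfwdE.
Qed.

Section iid_theory.
Context {d} {Omega : measurableType d} {R : realType} {T U : countType}.
Variables (P : probability Omega R) (zeta : nat -> Omega -> T) (mu : T -> R).
Hypothesis mu0 : forall t, 0 <= mu t.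
Hypothesis mu1 : (\esum_(t in [set: T]) (mu t)%:E = 1)%E.
Hypothesis zeta_iid : iid P zeta mu.

(** Interpolates between the cylinder events of the image sequence ([s2] empty) and those of [zeta]
    ([s1] empty). *)
Let event (f : T -> U) (s1 s2 : seq nat) (g : nat -> U) (h : nat -> T) : set Omega :=
  (\bigcap_(i in [set` s1]) [set w | f (zeta i w) = g i]) `&`
  (\bigcap_(i in [set` s2]) [set w | zeta i w = h i]).

(** Induction on [s1]: splitting according to the exact value [t] of [zeta i] moves the index [i]
    from [s1] to [s2], and summing over the fiber of [g i] produces the factor
    [pushfwd f mu (g i)]. *)
Lemma iid_map (f : T -> U) : iid P (fun i w => f (zeta i w)) (pushfwd f mu).
Proof.
have [mz Pz] := zeta_iid.
have mfz i u : measurable [set w | f (zeta i w) = u].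
  exact: (measurable_discrete (mz i) (f @^-1` [set u])).
have mev s1 s2 g h : measurable (event f s1 s2 g h).
  by apply: measurableI; apply: fin_bigcap_measurable => // i _.
suff H s1 : forall s2 g h, uniq (s1 ++ s2) -> P (event f s1 s2 g h) =
    (\prod_(i <- s1) pushfwd f mu (g i) * \prod_(i <- s2) mu (h i))%:E.
  (* The empty list [s2] still asks for some [h : nat -> T]. If [T] is empty, so is [Omega], against
     total mass 1. *)
  split => // s g us; have [[t0]|nT] := pselect (inhabited T).
    have := H s [::] g (fun=> t0); rewrite cats0 big_nil mulr1 => <- //.
    by rewrite /event [X in _ `&` X](_ : _ = setT) ?setIT//; apply/seteqP; split.
  exfalso; have w0 : P setT = 0%E.
    rewrite (_ : setT = set0) ?measure0//; apply/seteqP; split => // w _.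
    by apply: nT; exists; exact: zeta 0%N w.
  by move: w0; rewrite probability_setT => -[] /eqP; rewrite oner_eq0.
elim: s1 => [|i s1 IH] s2 g h us.
  rewrite /event big_nil mul1r -Pz//.
  by congr (P _); apply/seteqP; split => [w []|w ?]//; split.
have -> : event f (i :: s1) s2 g h =
    event f s1 s2 g h `&` [set w | (f @^-1` [set g i]) (zeta i w)].
  apply/seteqP; split => w.
    move=> [A B]; split => /=; last by apply: A; rewrite /= mem_head.
    by split => // j /= js; apply: A; rewrite /= inE js orbT.
  move=> [[A B] /= C]; split => // j; rewrite /= inE => /orP[/eqP -> //|js].
  exact: A.
rewrite (measure_discrete_sum (mz i))//.
move: us; rewrite /= => /andP[]; rewrite mem_cat negb_or => /andP[is1 is2] us.
transitivity (\esum_(t in f @^-1` [set g i])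
   ((\prod_(j <- s1) pushfwd f mu (g j) * \prod_(j <- s2) mu (h j))%:E * (mu t)%:E))%E.
  apply: eq_esum => t ft.
  pose h' j := if j == i then t else h j.
  have -> : event f s1 s2 g h `&` [set w | zeta i w = t] = event f s1 (i :: s2) g h'.
    apply/seteqP; split => w.
      move=> [[A B] C]; split => // j; rewrite /= /h' inE => /orP[/eqP ->|js].
        by rewrite eqxx.
      by case: eqP => [->//|_]; exact: B.
    move=> [A B]; split; first split => // j js.
      have := B j; rewrite /= /h' inE js orbT => /(_ isT).
      by case: eqP => // ji; rewrite -ji js in is2.
    by have := B i; rewrite /= /h' mem_head eqxx => /(_ isT).
  rewrite IH; last by rewrite uniq_catC /= uniq_catC us andbT mem_cat negb_or is1 is2.
  rewrite big_cons -EFinM; congr (_%:E).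
  rewrite {1}/h' eqxx [mu t * _]mulrC mulrA; congr (_ * _ * _).
  apply: eq_big_seq => j js; rewrite /h'; case: eqP => // ji.
  by rewrite -ji js in is2.
rewrite esumZl.
- by rewrite -pushfwdE// -EFinM big_cons mulrC mulrA.
- by rewrite mulr_ge0//; apply: prodr_ge0 => j _ //; exact: pushfwd_ge0.
- by move=> t; rewrite lee_fin.
Qed.

End iid_theory.

(** * Sequences generated by a measure-scaling map *)

Section iid_dynamics.
Context {d} {K : measurableType d} {R : realType} {T : countType}.
Variables (P : probability K R) (k : K -> T) (S : K -> K) (c : T -> R).
Hypothesis c0 : forall t, 0 <= c t.
Hypothesis c1 : (\esum_(t in [set: T]) (c t)%:E = 1)%E.
Hypothesis mk : forall t, measurable [set x | k x = t].
Hypothesis mS : forall B, measurable B -> measurable (S @^-1` B).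
Hypothesis PkS : forall t B, measurable B ->
  (P ([set x | k x = t] `&` S @^-1` B) = (c t)%:E * P B)%E.

(** Summing [PkS] over all [t] shows that [S] preserves [P]. *)
Let P_preimage B : measurable B -> P (S @^-1` B) = P B.
Proof.
move=> mB; have := measure_discrete_sum mk P setT (mS mB).
rewrite (_ : [set w | _] = setT) ?setIT; last by apply/seteqP; split.
move=> ->; transitivity (\esum_(t in [set: T]) (P B * (c t)%:E))%E.
  by apply: eq_esum => t _; rewrite muleC -PkS// setIC.
rewrite -(fineK (fin_num_measure P _ mB)) esumZl ?c1 ?mule1//.
by apply: fine_ge0; exact: measure_ge0.
Qed.

(** By [PkS], [k x] has law [c] and is independent of [S x], which again has law [P]. So the symbol
    at time 0 splits off, and the later ones are the same process read along [S x]. *)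
Lemma iid_iter : iid P (fun i x => k (iter i S x)) c.
Proof.
have mz i t : measurable [set x | k (iter i S x) = t].
  elim: i => [|i IH]; first exact: mk.
  by under eq_fun do rewrite iterSr; exact: (mS IH).
split => // s f us.
(* The induction is on a bound for the indices, which the shift by one lowers. *)
have [N sN] : exists N, forall i, i \in s -> (i < N)%N.
  by exists (\max_(i <- s) i).+1 => i si; rewrite ltnS; exact: leq_bigmax_seq.
elim: N s f us sN => [|N IH] s f us sN.
  have -> : s = [::] by case: s us sN => // i s _ /(_ i (mem_head _ _)).
  by rewrite set_nil bigcap_set0 probability_setT big_nil.
(* The conditions at positive times form the [S]-preimage of the cylinder given by [s'] and [f'].
   Index 0, if present, is handled by [PkS]; otherwise invariance of [P] suffices. *)
pose s' := [seq i.-1 | i <- s & (0 < i)%N]; pose f' i := f i.+1.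
have s'P i : (i \in s') = (i.+1 \in s).
  apply/mapP/idP => [[[|j] /[!mem_filter]//= sj ->//]|si].
  by exists i.+1; rewrite ?mem_filter.
have us' : uniq s'.
  rewrite map_inj_in_uniq ?filter_uniq// => -[|i] [|j]; rewrite !mem_filter//=.
  by move=> _ _ ->.
have {}IH : P (\bigcap_(i in [set` s']) [set x | k (iter i S x) = f' i]) =
    (\prod_(i <- s') c (f' i))%:E.
  by apply: IH => // i; rewrite s'P => /sN.
have mE : measurable (\bigcap_(i in [set` s']) [set x | k (iter i S x) = f' i]).
  by apply: fin_bigcap_measurable => // i _; exact: mz.
have prodE : \prod_(i <- s') c (f' i) = \prod_(i <- s | i != 0%N) c (f i).
  rewrite big_map big_filter; apply: eq_big => i; first by rewrite lt0n.
  by rewrite /f'; case: i.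
have [s0|s0] := boolP (0%N \in s).
  rewrite (bigD1_seq 0%N)//= -prodE EFinM -IH -PkS//; congr (P _).
  apply/seteqP; split => [x A|x [A B] [//|i] si].
    split; first exact: (A 0%N s0).
    move=> i /=; rewrite s'P => si; rewrite -iterSr; exact: (A i.+1 si).
  by have := B i; rewrite /= s'P -iterSr; exact.
rewrite big_seq_cond (eq_bigl (fun i => (i \in s) && (i != 0%N))); last first.
  by move=> i; rewrite andbT; case: eqP => [->|]; rewrite ?(negbTE s0) ?andbT.
rewrite -big_seq_cond -prodE -IH -(P_preimage mE); congr (P _).
apply/seteqP; split => [x A|x B [|i] si].
- by move=> i /=; rewrite s'P => si; rewrite -iterSr; exact: (A i.+1 si).
- by rewrite /= (negbTE s0) in si.
- by have := B i; rewrite /= s'P -iterSr; exact.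
Qed.

End iid_dynamics.

(** * Lebesgue measure under affine maps *)

Section lebesgue_affine.
Context {R : realType}.
Local Notation lambda := (@lebesgue_measure R).

Lemma measurable_affine_preimage (a c : R) (B : set R) : measurable B ->
  measurable ((fun x : R => (x - a) / c) @^-1` B).
Proof.
move=> mB; rewrite -[X in measurable X]setTI.
have : measurable_fun [set: R] (fun x : R => (x - a) / c).
  by apply: measurable_realfun.measurable_funM => //; exact: measurable_realfun.measurable_funB.
by move/(_ measurableT _ mB).
Qed.

(** The image of [lambda] under the map, scaled by [c^-1], agrees with [lambda] on the intervals
    []x, y]]; uniqueness of Lebesgue measure concludes. *)
Lemma lebesgue_measure_affine (a c : R) (B : set R) : 0 < c -> measurable B ->
  (lambda ((fun x : R => ((x - a) / c)%R) @^-1` B) = c%:E * lambda B)%E.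
Proof.
move=> c0 mB; pose f (x : R) := (x - a) / c.
have mf : measurable_fun [set: measurableTypeR R] (f : _ -> measurableTypeR R).
  by apply: measurable_realfun.measurable_funM => //; exact: measurable_realfun.measurable_funB.
have ci0 : 0 <= c^-1 by rewrite invr_ge0 ltW.
pose Pf : {measure set (measurableTypeR R) -> \bar R} :=
  measure_function_pushforward__canonical__measure_function_Measure lambda mf.
have -> : lambda B = mscale (NngNum ci0) Pf B.
  apply: lebesgue_measure_unique => // _ [[x y]] _ <-.
  have fE : f @^-1` `]x, y] = `]c * x + a, c * y + a]%classic.
    apply/seteqP; split => z; rewrite /= !in_itv/= /f ltr_pdivlMr// ler_pdivrMr//.
      by rewrite ltrBrDr lerBlDr ![_ * c]mulrC.
    by rewrite ltrBrDr lerBlDr ![_ * c]mulrC.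
  transitivity (c^-1%:E * lambda `](c * x + a)%R, (c * y + a)%R])%E; last by rewrite -fE.
  rewrite !lebesgue_measure_itv/= !lte_fin ltrD2r ltr_pM2l//.
  case: ifPn; rewrite ?mule0// => _.
  rewrite -!EFinB -EFinM opprD addrACA subrr addr0 -mulrBr mulKf//.
  by rewrite gt_eqF.
by rewrite /mscale muleA -EFinM divff ?mul1e// gt_eqF.
Qed.

End lebesgue_affine.

(** * Existence of independent sequences *)

Section unit_lebesgue.
Variable R : realType.
Local Notation lambda := (@lebesgue_measure R).

Let mI : measurable (`[0%R, 1%R[%classic : set (measurableTypeR R)).
Proof. exact: measurable_itv. Qed.

Definition unit_lebesgue : set (measurableTypeR R) -> \bar R := mrestr lambda mI.

HB.instance Definition _ := Measure.on unit_lebesgue.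

Let unit_lebesgueT : unit_lebesgue setT = 1%E.
Proof.
by rewrite /unit_lebesgue /mrestr setTI lebesgue_measure_itv/= lte_fin ltr01 oppr0 adde0.
Qed.

HB.instance Definition _ :=
  Measure_isProbability.Build _ _ _ unit_lebesgue unit_lebesgueT.

End unit_lebesgue.
Arguments unit_lebesgue : clear implicits.

(** * Coding the unit interval by a subdivision *)

Section subdivision.
Context {R : realType} (c : nat -> R).
Hypothesis c0 : forall n, 0 <= c n.
Hypothesis c1 : (\esum_(n in [set: nat]) (c n)%:E = 1)%E.

(** The [I n] are consecutive intervals of lengths [c n] that tile [[0, 1)]. Being half-open, [I n]
    is empty when [c n = 0]. *)
Let C n := \sum_(i < n) c i.
Let I n : set R := `[C n, C n.+1[%classic.

Let CS n : C n.+1 = C n + c n. Proof. by rewrite /C big_ord_recr. Qed.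

Let C_le : {homo C : m n / (m <= n)%N >-> m <= n}.
Proof. by apply: homo_leq => // [? ? ?|n]; [exact: le_trans|rewrite CS lerDl]. Qed.

Let C_ge0 n : 0 <= C n. Proof. by rewrite sumr_ge0. Qed.

Let serC : (\sum_(n <oo) (c n)%:E = 1)%E.
Proof. by rewrite nneseries_esumT// => n; rewrite lee_fin. Qed.

Let C_le1 n : C n <= 1.
Proof.
rewrite -lee_fin -serC /C -(big_mkord xpredT) -sumEFin.
by apply: nneseries_lim_ge => i _ _; rewrite lee_fin.
Qed.

Let I_inj m n x : I m x -> I n x -> m = n.
Proof.
rewrite /I /= !in_itv/= => /andP[mx xm] /andP[nx xn].
apply/eqP; rewrite eqn_leq; apply/andP; split; rewrite leqNgt; apply/negP => /C_le.
- by move=> /(le_trans) /(_ mx); rewrite leNgt xn.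
- by move=> /(le_trans) /(_ nx); rewrite leNgt xm.
Qed.

Let I_cover x : 0 <= x < 1 -> exists n, I n x.
Proof.
move=> /andP[x0 x1].
have exN : exists n, x < C n.
  apply: contrapT => /forallNP nx; suff : (1%:E <= x%:E)%E by rewrite lee_fin leNgt x1.
  rewrite -serC; apply: lime_le.
    by apply: is_cvg_nneseries => n _ _; rewrite lee_fin.
  apply: nearW => n; rewrite sumEFin lee_fin big_mkord leNgt.
  by apply/negP; exact: nx.
(* The least [N] with [x < C N] is positive since [C 0 = 0]; its predecessor is the index sought. *)
have [[|n] xn minn] := ex_minnP exN; first by rewrite /C big_ord0 ltNge x0 in xn.
exists n; rewrite /I /= in_itv/= xn andbT leNgt; apply/negP => /minn.
by rewrite ltnn.
Qed.

(** Points outside all [I n], that is outside [[0, 1)], receive the default index 0. They form a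
    null set for [unit_lebesgue], but make [n = 0] a special case for measurability. *)
Let k (x : R) : nat := xget 0%N [set n | I n x].
Let S (x : R) : R := (x - C (k x)) / c (k x).

Let kE n x : I n x -> k x = n.
Proof. by move=> Ix; apply: (I_inj _ Ix); exact: (@xgetPex _ 0%N [set n | I n x] (ex_intro _ n Ix)). Qed.

Let mI n : measurable (I n). Proof. exact: measurable_itv. Qed.

Let mk n : measurable [set x | k x = n].
Proof.
have -> : [set x | k x = n] =
    I n `|` ((~` \bigcup_m I m) `&` (if n == 0%N then setT else set0)).
  apply/seteqP; split => x /=.
    move=> kx; have [[m Im]|/forallNP nI] := pselect (exists m, I m x).
      by left; rewrite -kx (kE Im).
    right; split; first by move=> [m _ /nI].
    by rewrite -kx /k xgetPN.
  move=> [/kE//|[nI]]; case: eqP => // -> _; rewrite /k xgetPN// => m Im.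
  by apply: nI; exists m.
apply: measurableU => //; apply: measurableI; last by case: ifP.
by apply: measurableC; exact: bigcup_measurable.
Qed.

Let mS B : measurable B -> measurable (S @^-1` B).
Proof.
move=> mB.
have -> : S @^-1` B = \bigcup_n ([set x | k x = n] `&`
    ((fun x => (x - C n) / c n) @^-1` B)).
  by apply/seteqP; split => [x Bx|x [n _ [/= <-]]]//; exists (k x).
apply: bigcup_measurable => n _; apply: measurableI => //.
exact: measurable_affine_preimage.
Qed.

(** If [c n > 0], [S] maps [I n] affinely onto [[0, 1)], stretching lengths by [1 / c n]. If
    [c n = 0], [I n] is empty and both sides vanish. *)
Let PkS n (B : set (measurableTypeR R)) : measurable B ->
  (unit_lebesgue R ([set x | k x = n] `&` S @^-1` B) = (c n)%:E * unit_lebesgue R B)%E.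
Proof.
move=> mB; rewrite /unit_lebesgue /mrestr.
have -> : [set x | k x = n] `&` S @^-1` B `&` `[0, 1[ =
    I n `&` ((fun x => (x - C n) / c n) @^-1` B).
  apply/seteqP; split => x.
    move=> [[/= kx]]; rewrite /S kx in_itv/= => Bx /I_cover[m Im].
    by split => //; rewrite -kx (kE Im).
  move=> [In Bx]; split; first by split; rewrite /= /S (kE In).
  move: In; rewrite /I /= !in_itv/= => /andP[nx xn].
  by rewrite (le_trans (C_ge0 n) nx)/= (lt_le_trans xn).
have [cn0|cn0] := eqVneq (c n) 0.
  rewrite /I CS cn0 addr0 set_itvco0 ?set0I ?measure0 ?mul0e//.
rewrite -(lebesgue_measure_affine (C n))//; last 2 first.
- by rewrite lt_neqAle eq_sym cn0 c0.
- by apply: measurableI => //; exact: measurable_itv.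
congr (lebesgue_measure _); rewrite preimage_setI setIC; congr (_ `&` _).
have cn_gt0 : 0 < c n by rewrite lt_neqAle eq_sym cn0 c0.
apply/seteqP; split => x; rewrite /I /= !in_itv/= CS ltr_pdivrMr// mul1r
  pmulr_lge0 ?invr_gt0// subr_ge0 ltrBlDl//.
Qed.

Lemma iid_unit_lebesgue : exists zeta : nat -> measurableTypeR R -> nat,
  iid (unit_lebesgue R) zeta c.
Proof. by exists (fun i x => k (iter i S x)); exact: iid_iter. Qed.

End subdivision.

(** The law is moved to [nat] by [pickle], realised there, and the sequence decoded by [unpickle].
    Total mass 1 provides the default [t0] for codes of no element. *)
Lemma exists_iid {R : realType} {T : countType} (mu : T -> R) :
  (forall t, 0 <= mu t) -> (\esum_(t in [set: T]) (mu t)%:E = 1)%E ->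
  exists zeta : nat -> measurableTypeR R -> T, iid (unit_lebesgue R) zeta mu.
Proof.
move=> mu0 mu1.
have [t0] : inhabited T.
  apply: contrapT => nT; move: mu1; rewrite (_ : setT = set0) ?esum_set0.
    by move=> -[] /esym/eqP; rewrite oner_eq0.
  by apply/seteqP; split => // t _; apply: nT.
have p0 := pushfwd_ge0 pickle mu0; have p1 := pushfwd_sum1 pickle mu0 mu1.
have [zeta hz] := iid_unit_lebesgue p0 p1.
have := iid_map p0 p1 hz (fun n => odflt t0 (unpickle n)).
rewrite pushfwd_comp// (_ : _ \o _ = id); last first.
  by apply/funext => t /=; rewrite pickleK.
rewrite (_ : pushfwd id mu = mu); last by apply/funext => t; exact: pushfwd_id.
by move=> h; eexists; exact: h.
Qed.

(** * Finite prefixes and recurrence *)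

Section iid_prefix.
Context {R : realType} {T : countType} (t0 : T) (mu : T -> R).

Lemma mkseq_eq_bigcap {Omega : Type} (zeta : nat -> Omega -> T) N v :
  size v = N -> [set w | mkseq (zeta^~ w) N = v] =
  \bigcap_(i in [set` iota 0 N]) [set w | zeta i w = nth t0 v i].
Proof.
move=> sv; apply/seteqP; split => [w /= <- i|w /= H].
  by rewrite /= mem_iota add0n => /andP[_ iN]; rewrite nth_mkseq.
apply: (@eq_from_nth _ t0); rewrite size_mkseq// => i iN.
by rewrite nth_mkseq// H//= mem_iota.
Qed.

Lemma mkseq_eq_set0 {Omega : Type} (zeta : nat -> Omega -> T) N v :
  size v != N -> [set w | mkseq (zeta^~ w) N = v] = set0.
Proof.
move=> sv; apply/seteqP; split => // w /= E.
by move: sv; rewrite -E size_mkseq eqxx.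
Qed.

Lemma measurable_iid_prefix {d} {Omega : measurableType d} (P : probability Omega R)
  (zeta : nat -> Omega -> T) N v : iid P zeta mu ->
  measurable [set w | mkseq (zeta^~ w) N = v].
Proof.
move=> [mz _]; have [sv|sv] := eqVneq (size v) N; last by rewrite mkseq_eq_set0.
by rewrite mkseq_eq_bigcap//; apply: fin_bigcap_measurable.
Qed.

Context {d d'} {Omega : measurableType d} {Omega' : measurableType d'}.
Variables (P : probability Omega R) (P' : probability Omega' R).
Variables (zeta : nat -> Omega -> T) (zeta' : nat -> Omega' -> T).
Hypothesis zeta_iid : iid P zeta mu.
Hypothesis zeta'_iid : iid P' zeta' mu.

(** The event is a countable disjoint union over the possible prefixes, and the probability of each
    prefix is a product of values of [mu]. *)
Lemma iid_prefix_law N (D : set (seq T)) :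
  P [set w | D (mkseq (zeta^~ w) N)] = P' [set w | D (mkseq (zeta'^~ w) N)].
Proof.
rewrite -(setTI [set w | _]) -[in RHS](setTI [set w | _]).
have mz v := measurable_iid_prefix N v zeta_iid.
have mz' v := measurable_iid_prefix N v zeta'_iid.
rewrite !measure_discrete_sum//; apply: eq_esum => v _; rewrite !setTI.
have [sv|sv] := eqVneq (size v) N; last by rewrite !mkseq_eq_set0// !measure0.
have uN : uniq (iota 0 N) by exact: iota_uniq.
rewrite !mkseq_eq_bigcap//; transitivity (\prod_(i <- iota 0 N) mu (nth t0 v i))%:E.
  exact: zeta_iid.2.
exact/esym/zeta'_iid.2.
Qed.

(* The event only has to be an increasing union of events that depend on
   finitely many coordinates, so no uniqueness theorem for measures on the
   sequence space is needed. *)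
Lemma iid_ae_transfer (A : nat -> set (seq T)) :
  (forall x N, A N (mkseq x N) -> A N.+1 (mkseq x N.+1)) ->
  {ae P', forall w, exists N, A N (mkseq (zeta'^~ w) N)} ->
  {ae P, forall w, exists N, A N (mkseq (zeta^~ w) N)}.
Proof.
move=> AS.
pose E (Om : Type) (z : nat -> Om -> T) N := [set w | A N (mkseq (z^~ w) N)].
have ndE (Om : Type) (z : nat -> Om -> T) : nondecreasing_seq (E _ z).
  by apply/nondecreasing_seqP => N; apply/subsetPset => w /AS.
have mE N : measurable (E _ zeta N).
  apply: measurable_discrete => v; exact: (measurable_iid_prefix N v zeta_iid).
have mE' N : measurable (E _ zeta' N).
  apply: measurable_discrete => v; exact: (measurable_iid_prefix N v zeta'_iid).
have mU : measurable (\bigcup_N E _ zeta N) by exact: bigcup_measurable.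
have mU' : measurable (\bigcup_N E _ zeta' N) by exact: bigcup_measurable.
(* Continuity from below: the two sequences of probabilities coincide term by term, hence so do
   their limits. *)
have PU : P (\bigcup_N E _ zeta N) = P' (\bigcup_N E _ zeta' N).
  have c1 := nondecreasing_cvg_mu mE mU (ndE _ _) (mu := P).
  have c2 := nondecreasing_cvg_mu mE' mU' (ndE _ _) (mu := P').
  apply: (cvg_unique _ c1) => //.
  by rewrite (_ : P \o _ = P' \o E _ zeta')//; apply/funext => N; exact: iid_prefix_law.
move=> ae'.
have P'U : P' (~` \bigcup_N E _ zeta' N) = 0%E.
  apply: measure_negligible; first exact: measurableC.
  by apply: negligibleS ae' => w nU [N AN]; apply: nU; exists N.
exists (~` \bigcup_N E _ zeta N); split; first exact: measurableC.
- by rewrite probability_setC// PU -probability_setC.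
- by move=> w /= nA [N _ AN]; apply: nA; exists N.
Qed.

End iid_prefix.

Section iid_recurrence.
Context {d} {Omega : measurableType d} {R : realType} {T : countType}.
Variables (P : probability Omega R) (zeta : nat -> Omega -> T) (mu : T -> R).
Hypothesis mu0 : forall t, 0 <= mu t.
Hypothesis mu1 : (\esum_(t in [set: T]) (mu t)%:E = 1)%E.
Hypothesis zeta_iid : iid P zeta mu.

(** The indicators of [zeta i = t] are themselves independent, so [t] is missed during [k] steps
    from time [n] with probability [r ^+ k], where [r = 1 - mu t < 1]. *)
Lemma iid_hits n t : 0 < mu t ->
  {ae P, forall w, exists2 m, (n <= m)%N & zeta m w = t}.
Proof.
move=> t_gt0; have [mz Pz] := zeta_iid.
have [mb Pb] := iid_map mu0 mu1 zeta_iid (eq_op^~ t).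
set r := pushfwd (eq_op^~ t) mu false.
have r0 : 0 <= r by exact: pushfwd_ge0.
have r1 : r < 1.
  have := Pb [:: 0%N] (fun=> false) isT.
  rewrite set_cons1 bigcap_set1 big_seq1 -/r.
  have -> : [set w | (zeta 0 w == t) = false] = ~` [set w | zeta 0 w = t].
    by apply/seteqP; split => w /=; [move=> /eqP|move/eqP/negbTE].
  rewrite probability_setC//.
  have := Pz [:: 0%N] (fun=> t) isT; rewrite set_cons1 bigcap_set1 big_seq1 => ->.
  by move=> [<-]; rewrite ltrBlDr ltrDl.
pose B k := \bigcap_(i in [set` iota n k]) [set w | (zeta i w == t) = false].
have mB k : measurable (B k) by exact: fin_bigcap_measurable.
have PB k : P (B k) = (r ^+ k)%:E.
  by rewrite /B Pb ?iota_uniq// big_const_seq count_predT size_iota iter_mulr_1.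
exists (\bigcap_k B k); split; first exact: bigcap_measurable.
- apply/eqP; rewrite eq_le measure_ge0 andbT.
  have mBB : measurable (\bigcap_k B k) by exact: bigcap_measurable.
  rewrite -(fineK (fin_num_measure P _ mBB)) lee_fin.
  have cvg0 : r ^+ k @[k --> \oo] --> (0 : R) by apply: cvg_expr; rewrite ger0_norm.
  rewrite -(cvg_lim _ cvg0)//; apply: limr_ge; first by apply/cvg_ex; exists 0.
  apply: nearW => k; rewrite -lee_fin -PB fineK ?fin_num_measure//.
  by apply: le_measure; rewrite ?inE//; exact: bigcap_inf.
- move=> w /= nw k _ i /=; rewrite mem_iota => /andP[ni _].
  by apply/negP => /eqP zi; apply: nw; exists i.
Qed.

End iid_recurrence.

(** * Groups and random walks *)

Section cgroup_theory.
Variable G : cgroup.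
Local Notation "x * y" := (@gmul G x y).
Local Notation "x ^-1" := (@ginv G x).
Local Notation "1" := (@gone G).

Lemma gmulKV (x y : G) : x^-1 * (x * y) = y.
Proof. by rewrite gmulA gmulVg gmul1g. Qed.

(** The axioms are one-sided; left cancellation yields the right unit and right inverse laws
    below. *)
Lemma gmulI (x : G) : injective (@gmul G x).
Proof. by move=> y z /(congr1 (@gmul G x^-1)); rewrite !gmulKV. Qed.

Lemma gmulg1 (x : G) : x * 1 = x.
Proof. by apply: (@gmulI x^-1); rewrite gmulKV gmulVg. Qed.

Lemma gmulgV (x : G) : x * x^-1 = 1.
Proof. by apply: (@gmulI x^-1); rewrite gmulKV gmulg1. Qed.

Lemma ginvK : involutive (@ginv G).
Proof. by move=> x; apply: (@gmulI x^-1); rewrite gmulgV gmulVg. Qed.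

Lemma gprod_cat (s t : seq G) : gprod (s ++ t) = gprod s * gprod t.
Proof. by elim: s => [|x s IH] /=; rewrite ?gmul1g// IH gmulA. Qed.

Lemma semigroup_gen_sub (A : set G) x : A x -> semigroup_gen A x.
Proof.
move=> Ax; exists [:: x]; split => //; split; last by rewrite /= gmulg1.
by move=> y; rewrite inE => /eqP ->.
Qed.

Lemma semigroup_gen_mul (A : set G) x y :
  semigroup_gen A x -> semigroup_gen A y -> semigroup_gen A (x * y).
Proof.
move=> [s [s0 [As ->]]] [t [_ [At ->]]]; exists (s ++ t); rewrite gprod_cat.
split; first by case: s s0 {As}.
by split => // z; rewrite mem_cat => /orP[/As|/At].
Qed.

(** Words are replaced by lists of indices. For a walk these are lists of times, which can be kept
    while the walk is projected or read off a finite prefix. *)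
Lemma semigroup_gen_image (I : eqType) (D : set I) (f : I -> G) g :
  semigroup_gen [set f i | i in D] g <->
  exists l : seq I, [/\ l != [::], forall i, i \in l -> D i & g = gprod (map f l)].
Proof.
split=> [[s [s0 [As ->]]]|[l [l0 Dl ->]]]; last first.
  exists (map f l); split; first by case: l l0 {Dl}.
  by split => // _ /mapP[i li ->]; exists i => //; exact: Dl.
have [l [Dl sl]] : exists l : seq I, (forall i, i \in l -> D i) /\ s = map f l.
  elim: s As {s0} => [|x s IH] As; first by exists [::].
  have [//|l [Dl ->]] := IH; first by move=> y sy; apply: As; rewrite inE sy orbT.
  have [i Di <-] := As x (mem_head _ _).
  by exists (i :: l); split => // j; rewrite inE => /orP[/eqP ->|/Dl].
exists l; split => //; last by rewrite sl.
by apply: contra_neq s0 => l0; rewrite sl l0.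
Qed.

Lemma gprod_closed (S : set G) (s : seq G) :
  S 1 -> (forall x y, S x -> S y -> S (x * y)) ->
  (forall x, x \in s -> S x) -> S (gprod s).
Proof.
move=> S1 SM; elim: s => //= x s IH Ss; apply: SM; first by apply: Ss; rewrite mem_head.
by apply: IH => y sy; apply: Ss; rewrite inE sy orbT.
Qed.

Lemma gpowS (x : G) n : gpow x n.+1 = x * gpow x n. Proof. by []. Qed.

Lemma rwalkS {Omega : Type} (zeta : nat -> Omega -> G) m w :
  rwalk zeta m.+1 w = rwalk zeta m w * zeta m w.
Proof.
by rewrite /rwalk -{1}addn1 iotaD map_cat gprod_cat /= gmulg1.
Qed.

Lemma rwalk_take {Omega : Type} (zeta : nat -> Omega -> G) m N w : (m <= N)%N ->
  rwalk zeta m w = gprod (take m (mkseq (zeta^~ w) N)).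
Proof. by move=> mN; rewrite /mkseq -map_take take_iota (minn_idPl mN). Qed.

End cgroup_theory.

(** * Homomorphisms and torsion kernels *)

Section homomorphisms.
Variables (G Q : cgroup) (pi : G -> Q).
Hypothesis pi_hom : group_hom pi.

Lemma hom_one : pi (gone G) = gone Q.
Proof.
by apply: (@gmulI _ (pi (gone G))); rewrite -pi_hom gmul1g gmulg1.
Qed.

Lemma hom_inv x : pi (ginv x) = ginv (pi x).
Proof. by apply: (@gmulI _ (pi x)); rewrite -pi_hom !gmulgV hom_one. Qed.

Lemma hom_prod s : pi (gprod s) = gprod (map pi s).
Proof. by elim: s => [|x s IH] /=; rewrite ?hom_one// pi_hom IH. Qed.

Lemma hom_rwalk {Omega : Type} (zeta : nat -> Omega -> G) m w :
  pi (rwalk zeta m w) = rwalk (fun i w => pi (zeta i w)) m w.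
Proof. by rewrite /rwalk hom_prod -map_comp. Qed.

(* For s in S pick t in S above the inverse of the image of s: then st is
   torsion, and s^-1 = t (st)^(k-1). *)
Lemma torsion_semigroup_inv (S : set G) :
  (forall x y, S x -> S y -> S (gmul x y)) ->
  (forall q, exists2 x, S x & pi x = q) ->
  (forall x, pi x = gone Q -> exists n, (0 < n)%N /\ gpow x n = gone G) ->
  forall x, S x -> S (ginv x).
Proof.
move=> SM Sonto tor x Sx; have [y Sy piy] := Sonto (ginv (pi x)).
have [|n [n_gt0]] := tor (gmul x y); first by rewrite pi_hom piy gmulgV.
case: n n_gt0 => // n _; rewrite gpowS => xyn; suff -> : ginv x = gmul y (gpow (gmul x y) n).
  elim: n {xyn} => [|n IH]; first by rewrite gmulg1.
  by rewrite gpowS -gmulA; exact: SM Sy (SM _ _ Sx IH).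
by apply: (@gmulI _ x); rewrite gmulgV gmulA.
Qed.

Variable R : realType.
Hypothesis pi_surj : forall q, exists g, pi g = q.

Lemma pushfwd_symmetric (mu : G -> R) : symmetric_prob mu ->
  symmetric_prob (pushfwd pi mu).
Proof.
move=> mus q; congr fine.
rewrite [RHS](@reindex_esum _ _ _ (pi @^-1` [set q]) _ (@ginv G)).
  by apply: eq_esum => g _; rewrite -mus.
split.
- by move=> g /= <-; rewrite hom_inv.
- by move=> x y _ _ /(can_inj (@ginvK G)).
- by move=> g /= piq; exists (ginv g); rewrite ?ginvK//= hom_inv piq ginvK.
Qed.

Lemma AR_group_of_quotient :
  (forall g, pi g = gone Q -> exists n, (0 < n)%N /\ gpow g n = gone G) ->
  AR_group Q R -> AR_group G R.
Proof.
move=> tor ARQ mu [mu0 mu1] mus mugen d Omega P zeta zeta_iid n.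
have ziid : iid P zeta mu := zeta_iid.
(* The image of the support of [mu] lies in the support of its pushforward, so a generating word in
   [G] projects to one in [Q]. *)
have nugen : group_gen (Defs.support (pushfwd pi mu)) = [set: Q].
  apply/seteqP; split => // q _; have [g <-] := pi_surj q.
  have [s [As ->]] : group_gen (Defs.support mu) g by rewrite mugen.
  exists (map pi s); split; last by rewrite hom_prod.
  move=> _ /mapP[x sx ->]; have [mux|mux] := As x sx; [left|right].
    exact: lt_le_trans mux (pushfwd_ge pi mu0 mu1 _).
  by rewrite -hom_inv; exact: lt_le_trans mux (pushfwd_ge pi mu0 mu1 _).
have nuiid : iid_law P (fun i w => pi (zeta i w)) (pushfwd pi mu).
  exact: (iid_map mu0 mu1 ziid).
have aeQ := ARQ _ (conj (pushfwd_ge0 pi mu0) (pushfwd_sum1 pi mu0 mu1))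
  (pushfwd_symmetric mus) nugen _ _ _ _ nuiid n.
(* Countability of [G], through [pickle], gives one almost sure event on which every support element
   occurs as an increment after time [n]. *)
have aeG : {ae P, forall w, forall g, 0 < mu g ->
    exists2 m, (n <= m)%N & zeta m w = g}.
  have : forall k, {ae P, forall w, forall g, unpickle k = Some g -> 0 < mu g ->
      exists2 m, (n <= m)%N & zeta m w = g}.
    move=> k; case: (unpickle k) => [g|]; last by apply: aeW.
    have [g0|g0] := boolP (0 < mu g).
      by apply: filterS (iid_hits mu0 mu1 ziid n g0) => w h _ [<-].
    by apply: aeW => w _ [<-] g0'; rewrite g0' in g0.
  move=> /ae_foralln; apply: filterS => w h g; apply: (h (pickle g)).
  by rewrite pickleK.
apply: filterS2 aeQ aeG => w hQ hG.
set S := semigroup_gen _.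
have SM x y : S x -> S y -> S (gmul x y) by exact: semigroup_gen_mul.
have SX m : (n <= m)%N -> S (rwalk zeta m w).
  by move=> nm; apply: semigroup_gen_sub; exists m.
(* A word in the positions of the projected walk lifts to the word in the positions of [rwalk zeta]
   at the same times. *)
have Sonto q : exists2 x, S x & pi x = q.
  have : [set: Q] q by []. 
  rewrite -hQ => /semigroup_gen_image [l [l0 nl ->]].
  exists (gprod [seq rwalk zeta m w | m <- l]).
    by apply/semigroup_gen_image; exists l.
  by rewrite hom_prod -map_comp; congr gprod; apply: eq_map => m /=; exact: hom_rwalk.
have SV := torsion_semigroup_inv SM Sonto tor.
have S1 : S (gone G).
  by rewrite -(gmulVg (rwalk zeta n w)); apply: SM; [apply: SV|]; exact: SX.
(* An increment is the quotient of consecutive positions, and [S] is closed under inverses. *)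
have Smu g : 0 < mu g -> S g.
  move=> /hG[m nm <-]; rewrite -(gmulKV (rwalk zeta m w) (zeta m w)) -rwalkS.
  by apply: SM; [apply: SV|]; apply: SX => //; exact: leqW.
apply/seteqP; split => // g _.
have [s [As ->]] : group_gen (Defs.support mu) g by rewrite mugen.
apply: gprod_closed => // x /As[/Smu//|/Smu/SV]; by rewrite ginvK.
Qed.

End homomorphisms.

(** * Lifting a law to the extension *)

(** The dyadic weights of the codes have total at most 1, possibly less since [pickle] may skip
    codes, and positive thanks to [t0]; they are then normalised. *)
Lemma exists_positive_prob (R : realType) (T : countType) (t0 : T) :
  exists2 W : T -> R, (forall t, 0 < W t) &
    (\esum_(t in [set: T]) (W t)%:E = 1)%E.
Proof.
pose w (t : T) : R := 1 / (2 ^ (pickle t).+1)%:R.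
have w_gt0 t : 0 < w t by rewrite divr_gt0// ltr0n expn_gt0.
have w0 t : (0 <= (w t)%:E)%E by rewrite lee_fin ltW.
set s := (\esum_(t in [set: T]) (w t)%:E)%E.
have s_le1 : (s <= 1)%E.
  rewrite /s -(@esum_image _ _ _ _ pickle (fun n => (1 / (2 ^ n.+1)%:R)%:E)); last first.
    by move=> x y _ _; exact: (pcan_inj pickleK).
  have -> : pickle @` [set: T] = [set n | n \in pickle @` [set: T]].
    by apply/seteqP; split => n /=; rewrite inE.
  rewrite -nneseries_esum; first exact: epsilon_trick0.
  by move=> n _; rewrite lee_fin divr_ge0.
have s_fin : s \is a fin_num.
  by rewrite ge0_fin_numE ?(le_lt_trans s_le1) ?ltry//; exact: esum_ge0.
have s_gt0 : (0 < s)%E.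
  apply: (@lt_le_trans _ _ (w t0)%:E); first by rewrite lte_fin.
  rewrite -(@esum_set1 _ _ t0 (fun t => (w t)%:E))// esum_mkcond.
  by apply: le_esum => t _; case: ifP.
have fs_gt0 : 0 < fine s by rewrite fine_gt0// s_gt0 ltey_eq s_fin.
exists (fun t => (fine s)^-1 * w t); first by move=> t; rewrite mulr_gt0// invr_gt0.
under eq_esum do rewrite EFinM.
rewrite esumZl//; last by rewrite invr_ge0 ltW.
by rewrite -/s -[X in (_ * X)%E](fineK s_fin) -EFinM mulVf// gt_eqF.
Qed.

Section lift.
Context {R : realType} (G Q : cgroup) (pi : G -> Q).
Hypothesis pi_hom : group_hom pi.
Hypothesis pi_surj : forall q, exists g, pi g = q.

(* Spread nu q over the fiber of q with positive weights, then average with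
   the inverted weights to restore symmetry. *)
Lemma exists_symmetric_lift (nu : Q -> R) : prob_on nu -> symmetric_prob nu ->
  exists mu : G -> R, [/\ prob_on mu, symmetric_prob mu, pushfwd pi mu = nu &
    forall g, 0 < nu (pi g) -> 0 < mu g].
Proof.
move=> [nu0 nu1] nus.
have [W W_gt0 W1] := exists_positive_prob R (gone G).
have W0 g : 0 <= W g by exact: ltW.
pose V := pushfwd pi W.
have V_gt0 q : 0 < V q.
  by have [g <-] := pi_surj q; exact: lt_le_trans (W_gt0 g) (pushfwd_ge pi W0 W1 g).
(* The mass [nu q] is shared over the fiber of [q] in proportion to [W], whose mass there is
   [V q]. *)
pose m g := nu (pi g) / V (pi g) * W g.
have m0 g : 0 <= m g by rewrite mulr_ge0// divr_ge0// ltW.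
have m_fib q : (\esum_(g in pi @^-1` [set q]) (m g)%:E = (nu q)%:E)%E.
  transitivity (\esum_(g in pi @^-1` [set q]) ((nu q / V q)%:E * (W g)%:E))%E.
    by apply: eq_esum => g /= <-; rewrite -EFinM.
  rewrite esumZl; last 2 first.
  - by rewrite divr_ge0// ltW.
  - by move=> g; rewrite lee_fin.
  by rewrite -(pushfwdE pi W0 W1) -EFinM -mulrA mulVf ?mulr1// gt_eqF.
(* Inversion carries the fiber of [q] onto that of its inverse, which has the same [nu]-mass by
   symmetry. *)
have mV_fib q : (\esum_(g in pi @^-1` [set q]) (m (ginv g))%:E = (nu q)%:E)%E.
  rewrite nus -m_fib [RHS](@reindex_esum _ _ _ (pi @^-1` [set q]) _ (@ginv G))//.
  split.
  - by move=> g /= <-; rewrite hom_inv.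
  - by move=> x y _ _ /(can_inj (@ginvK G)).
  - by move=> g /= piq; exists (ginv g); rewrite ?ginvK//= hom_inv// piq ginvK.
pose mu g := 2^-1 * (m g + m (ginv g)).
have mu0 g : 0 <= mu g by rewrite mulr_ge0// addr_ge0.
have mu_fib q : (\esum_(g in pi @^-1` [set q]) (mu g)%:E = (nu q)%:E)%E.
  under eq_esum do rewrite /mu EFinM EFinD.
  rewrite esumZl//; last by move=> g; rewrite -EFinD lee_fin addr_ge0.
  rewrite esumD ?m_fib ?mV_fib; try by move=> g _; rewrite lee_fin.
  by rewrite -EFinD -EFinM -mulr2n -[nu q *+ 2]mulr_natl mulKf// pnatr_eq0.
have mu1 : (\esum_(g in [set: G]) (mu g)%:E = 1)%E.
  rewrite -(preimage_setT pi) -esum_fibers; last by move=> g; rewrite lee_fin.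
  by rewrite -nu1; apply: eq_esum => q _.
exists mu; split => //.
- by move=> g; rewrite /mu ginvK addrC.
- by apply/funext => q; rewrite /pushfwd mu_fib.
- move=> g nug; rewrite /mu mulr_gt0// ?invr_gt0// ltr_pwDl//.
  by rewrite /m mulr_gt0// divr_gt0.
Qed.

(** A word for [pi g] lifts letter by letter to [t], leaving an error [z] in the kernel. With [x0]
    above [q0], both [x0] and [x0 z] lie in the support of [mu], and [z] is the product of the
    inverse of [x0] and [x0 z]. *)
Lemma lift_generates (nu : Q -> R) (mu : G -> R) :
  (forall g, 0 < nu (pi g) -> 0 < mu g) ->
  symmetric_prob nu -> (exists q, 0 < nu q) ->
  group_gen (Defs.support nu) = [set: Q] ->
  group_gen (Defs.support mu) = [set: G].
Proof.
move=> numu nus [q0 nuq0] nugen; apply/seteqP; split => // g _.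
have [s [As gs]] : group_gen (Defs.support nu) (pi g) by rewrite nugen.
have [t [At ts]] : exists t : seq G,
    (forall x, x \in t -> 0 < nu (pi x)) /\ map pi t = s.
  elim: s As {gs} => [|q s IH] As; first by exists [::].
  have [//|t [At <-]] := IH; first by move=> y sy; apply: As; rewrite inE sy orbT.
  have [x pix] := pi_surj q.
  exists (x :: t); split; last by rewrite /= pix.
  move=> y; rewrite inE => /orP[/eqP ->|/At//].
  (* Symmetry of [nu] puts letters known only through their inverses into the support as well. *)
  by have [|] := As q (mem_head _ _); rewrite /Defs.support /= pix// -nus.
have [x0 pix0] := pi_surj q0.
pose z := gmul (ginv (gprod t)) g.
have piz : pi z = gone Q by rewrite pi_hom hom_inv// hom_prod// ts -gs gmulVg.
exists (t ++ [:: ginv x0; gmul x0 z]); split.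
  move=> x; rewrite mem_cat !inE => /or3P[/At/numu|/eqP ->|/eqP ->]; [by left|right|left].
    by apply: numu; rewrite ginvK pix0.
  by apply: numu; rewrite pi_hom piz gmulg1 pix0.
rewrite gprod_cat /= gmulg1 gmulKV /z gmulA gmulgV gmul1g//.
Qed.

Lemma AR_quotient_of_group : AR_group G R -> AR_group Q R.
Proof.
move=> ARG nu nuP nus nugen d Omega P zeta zeta_iid n.
have [mu [muP mus munu numu]] := exists_symmetric_lift nuP nus.
have exq : exists q, 0 < nu q.
  apply: contrapT => /forallNP nq; have := nuP.2.
  rewrite esum1; first by move=> -[] /esym/eqP; rewrite oner_eq0.
  move=> q _; congr _%:E; apply/eqP; rewrite eq_le nuP.1 andbT leNgt.
  exact/negP/nq.
have mugen := lift_generates numu nus exq nugen.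
have [xi xi_iid] := exists_iid muP.1 muP.2.
have piiid := iid_map muP.1 muP.2 xi_iid pi; rewrite munu in piiid.
have aeG := ARG mu muP mus mugen _ _ _ xi xi_iid n.
pose walks (f : nat -> Q) q (l : seq nat) :=
  [/\ l != [::], forall m, m \in l -> (n <= m)%N & q = gprod (map f l)].
(* [A q N v] says that [q] is a product of walk positions at times between [n] and [N], read off the
   prefix [v] of length [N]. *)
pose A q N (v : seq Q) := exists2 l : seq nat, all (fun m => (m <= N)%N) l &
  walks (fun m => gprod (take m v)) q l.
have AE (Om : Type) (z : nat -> Om -> Q) w q : semigroup_gen
    [set rwalk z m w | m in [set m | (n <= m)%N]] q <->
    exists N, A q N (mkseq (z^~ w) N).
  rewrite semigroup_gen_image; split => [[l [l0 nl ->]]|[N [l lN [l0 nl ->]]]].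
    have lN : all (fun m => (m <= \max_(i <- l) i)%N) l.
      by apply/allP => m lm; exact: leq_bigmax_seq.
    exists (\max_(i <- l) i)%N, l => //; split => //; congr gprod.
    by apply/eq_in_map => m /(allP lN) ?; rewrite (@rwalk_take _ _ _ _ (\max_(i <- l) i)%N).
  exists l; split => //; congr gprod.
  by apply/eq_in_map => m /(allP lN) ?; rewrite (@rwalk_take _ _ _ _ N).
have AS q x N : A q N (mkseq x N) -> A q N.+1 (mkseq x N.+1).
  move=> [l lN [l0 nl qE]]; exists l; first by apply: sub_all lN => m /leqW.
  split => //; rewrite qE; congr gprod; apply/eq_in_map => m /(allP lN) mN.
  by rewrite /mkseq -!map_take !take_iota (minn_idPl mN) (minn_idPl (leqW mN)).
(* For a fixed [q] the event is an increasing union of prefix events and so can be transferred; all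
   [q] are then combined by countability of [Q]. *)
have aeA q : {ae P, forall w, exists N, A q N (mkseq (zeta^~ w) N)}.
  apply: (iid_ae_transfer (gone Q) zeta_iid piiid (@AS q)).
  apply: filterS aeG => w hG; apply/(AE _ (fun i w => pi (xi i w))).
  have [g <-] := pi_surj q.
  have : [set: G] g by [].
  rewrite -hG => /semigroup_gen_image[l [l0 nl ->]].
  apply/semigroup_gen_image; exists l; split => //.
  by rewrite hom_prod// -map_comp; congr gprod; apply: eq_map => m /=; exact: hom_rwalk.
have /ae_foralln : forall k, {ae P, forall w, forall q, unpickle k = Some q ->
    exists N, A q N (mkseq (zeta^~ w) N)}.
  move=> k; case: (unpickle k) => [q|]; last exact: aeW.
  by apply: filterS (aeA q) => w h _ [<-].
apply: filterS => w h; apply/seteqP; split => // q _.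
by apply/AE/(h (pickle q)); rewrite pickleK.
Qed.

End lift.

Local Close Scope ring_scope.

(* G/H is represented by any countable group Q with a surjective
   homomorphism pi : G -> Q whose kernel is exactly H. *)
Theorem theorem2 (R : realType) (G : cgroup) (H : set G)
  (HN : normal_subgroup H) (Htor : torsion_set H)
  (Q : cgroup) (pi : G -> Q) (pi_hom : group_hom pi) (pi_surj : forall q : Q, exists g : G, pi g = q)
  (pi_ker : forall g, pi g = gone Q <-> H g) :
  AR_group Q R <-> AR_group G R.
Proof.
split; last exact: AR_quotient_of_group.
apply: AR_group_of_quotient => // g /pi_ker; exact: Htor.
Qed.
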